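(* Let $\lambda\in(1/2,1)$ be the reciprocal of a Garsia number. Let $X=[0,1]^2$, $S_0(x)=\lambda x$, $S_1(x)=\lambda x+(1-\lambda,0)$, $C=\{0\}\times[0,1]$, and let $F_C^\lambda$ be the unique non-empty compact set satisfying $F_C^\lambda=S_0(F_C^\lambda)\cup S_1(F_C^\lambda)\cup C$. Then, as $\delta\to0$, \[ \frac{\log N_\delta(F_C^\lambda)}{-\log\delta}=\frac{\log(4\lambda)}{\log 2}+O\Big(\frac{1}{-\log\delta}\Big). \]
   Context: A Garsia number is a positive real algebraic integer with norm $\pm2$ all of whose Galois conjugates have modulus strictly greater than $1$. For bounded $E\subseteq\mathbb{R}^2$ and $\delta>0$, $N_\delta(E)$ is the number of half-open squares (products of half-open intervals $[a,b)$) of the $\delta$-mesh aligned with the coordinate axes that intersect $E$. *)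

(* Defs.v *)
From HB Require Import structures.
From mathcomp Require Import all_boot all_order all_algebra.
From mathcomp Require Import all_classical all_reals all_analysis.
From mathcomp Require Import complex finmap.
Set Implicit Arguments. Unset Strict Implicit. Unset Printing Implicit Defensive.
Import Order.TTheory GRing.Theory Num.Theory numFieldNormedType.Exports.
Local Open Scope classical_set_scope.
Local Open Scope ring_scope.

(* Garsia number: positive real algebraic integer with norm +-2 whose Galois
   conjugates all have modulus > 1.  Its minimal polynomial over Q is a monic
   integer polynomial p (Gauss), irreducible over Q; the norm is
   (-1)^deg * p(0), so norm = +-2 iff p`_0 = +-2; the Galois conjugates are
   the complex roots of p. *)
Definition garsia (R : realType) (x : R) : Prop :=
  0 < x /\
  exists p : {poly int},
    [/\ p \is monic,
        irreducible_poly (map_poly (intr : int -> rat) p),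
        root (map_poly (intr : int -> R) p) x,
        (p`_0 = 2 \/ p`_0 = -2) &
        forall z : R[i], root (map_poly (intr : int -> R[i]) p) z -> 1 < `|z|].

Definition mesh_squares (R : realType) (delta : R) (E : set (R * R)) : set (int * int) :=
  [set ij | exists2 p, E p &
     (ij.1%:~R * delta <= p.1 < (ij.1 + 1)%:~R * delta) /\
     (ij.2%:~R * delta <= p.2 < (ij.2 + 1)%:~R * delta)].

Definition N_delta (R : realType) (delta : R) (E : set (R * R)) : nat :=
  (#|` fset_set (mesh_squares delta E)|)%fset.

Definition S0 (R : realType) (lam : R) (x : R * R) : R * R := (lam * x.1, lam * x.2).
Definition S1 (R : realType) (lam : R) (x : R * R) : R * R :=
  (lam * x.1 + (1 - lam), lam * x.2).
Definition Cseg (R : realType) : set (R * R) :=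
  [set x | x.1 = 0 /\ 0 <= x.2 <= 1].

(* Main.v *)
Require Import Defs.
From HB Require Import structures.
From mathcomp Require Import all_boot all_order all_algebra.
From mathcomp Require Import all_classical all_reals all_analysis.
From mathcomp Require Import complex finmap ring lra zify.
Set Implicit Arguments. Unset Strict Implicit. Unset Printing Implicit Defensive.
Import Order.TTheory GRing.Theory Num.Theory numFieldNormedType.Exports.
Local Open Scope classical_set_scope.
Local Open Scope ring_scope.

(* F is the union of the pillars {a_w} x [0, lam^|w|] over binary words w, where
   a_w is the abscissa of S_w(0), together with a segment on the horizontal axis.
   Garsia's lemma: two such abscissae of level k differ by lam^(k-1) times the
   value at x = 1/lam of a nonzero polynomial Q with coefficients in {-1, 0, 1}.
   The product of Q over the conjugates of x is a nonzero integer, every factor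
   at a conjugate z other than x is at most |z|^k / (|z| - 1), and these z have
   product of moduli 2 / x; hence the abscissae of level k are separated by a
   constant times 2^-k.  For delta comparable to 2^-k, the 2^k pillars of level k
   lie in distinct columns and give at least T = (2 lam)^k / delta squares, while
   the pillars of lower levels (a geometric sum, since 2 lam > 1) and the strip of
   height O(lam^k) containing the rest of F meet O(T) squares.  Taking logarithms
   gives the theorem. *)

(** * Products of polynomial values over conjugates *)

Lemma horner_char_poly (F : comNzRingType) n (A : 'M[F]_n) (b : F) :
  (char_poly A).[b] = \det (b%:M - A).
Proof.
rewrite -horner_evalE -det_map_mx; congr (\det _).
apply/matrixP => i j; rewrite !mxE /= horner_evalE.
by rewrite hornerD hornerN hornerC hornerMn hornerX.
Qed.

(** Splitting [q] into linear factors reduces this to [\det (A - b)], the characteristic polynomial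
    at [b] up to a sign that turns each factor [b - z] into [z - b]. *)
Lemma det_horner_mx (F : closedFieldType) n (A : 'M[F]_n.+1) (s : seq F) (q : {poly F}) :
  char_poly A = \prod_(z <- s) ('X - z%:P) ->
  \det (horner_mx A q) = \prod_(z <- s) q.[z].
Proof.
move=> As; have [r ->] := closed_field_poly_normal q.
have szs : size s = n.+1.
  have := size_prod_XsubC s id; rewrite /= -As size_char_poly.
  by case.
rewrite linearZ /= detZ rmorph_prod /=.
rewrite (big_morph (@determinant F n.+1) (@det_mulmx F n.+1) (@det1 F n.+1)).
under [in RHS]eq_bigr => z _ do rewrite hornerZ horner_prod.
rewrite big_split /= big_const_seq count_predT szs iter_mulr_1.
congr (_ * _); rewrite exchange_big /=; apply: eq_bigr => b _.
rewrite rmorphB /= horner_mx_X horner_mx_C -opprB -scaleN1r detZ.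
rewrite -horner_char_poly As horner_prod -szs.
elim: {As szs} s => [|z s IH]; first by rewrite !big_nil mulr1.
by rewrite !big_cons -IH /= !hornerXsubC exprS; ring.
Qed.

(** The product is the determinant of [q] evaluated at the companion matrix of [p], which has
    integer entries. *)
Lemma prod_roots_int (F : closedFieldType) (p q : {poly int}) (s : seq F) :
  p \is monic -> map_poly intr p = \prod_(z <- s) ('X - z%:P) ->
  exists m : int, \prod_(z <- s) (map_poly intr q).[z] = m%:~R.
Proof.
move=> mp ps.
have [n [A chA]] : exists n (A : 'M[int]_n), char_poly A = p.
  by exists (size p).-1, (companionmx p); exact: companionmxK.
(* Evaluation at a matrix requires positive dimension; in dimension 0, [p] is 1 and the product is
   empty. *)
case: n A chA => [|n] A chA.
  move: ps; rewrite -chA /char_poly det_mx00 rmorph1 => /(congr1 (size \o polyseq)) /=.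
  rewrite size_poly1 size_prod_XsubC => -[/esym/size0nil ->].
  by exists 1; rewrite big_nil.
exists (\det (horner_mx A q)).
rewrite -det_map_mx map_horner_mx (@det_horner_mx _ _ _ s) //.
by rewrite -map_char_poly chA.
Qed.

(** A common root would force the irreducible [p] to divide [q] over the rationals, hence over the
    integers since [p] is monic. The lowest nonzero coefficient of [q] would then be a nonzero
    integer times the constant term of [p], of modulus at least 2. *)
Lemma small_poly_not_root (F : numFieldType) (p q : {poly int}) (z : F) :
  p \is monic -> irreducible_poly (map_poly (intr : int -> rat) p) ->
  p`_0 = 2 \/ p`_0 = -2 -> (forall i, `|q`_i| <= 1) -> q != 0 ->
  root (map_poly intr p) z -> ~~ root (map_poly intr q) z.
Proof.
move=> mp irr p0 qs q0 rp.
have mapQ (r : {poly int}) :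
    map_poly (intr : int -> F) r = map_poly (ratr : rat -> F) (map_poly intr r).
  by rewrite -map_poly_comp; apply: eq_map_poly => i /=; rewrite ratr_int.
have [dv|ndv] := boolP (map_poly (intr : int -> rat) p %| map_poly intr q); last first.
  rewrite mapQ rootE; apply: (@coprimep_root _ (map_poly ratr (map_poly intr p)));
    last by rewrite -mapQ.
  by rewrite coprimep_map irreducible_poly_coprime.
move: dv; rewrite dvdp_rat_int => /(Pdiv.IdomainMonic.dvdpP mp) [r qr].
exfalso.
have r0 : r != 0 by apply: contraNneq q0 => r0; rewrite qr r0 mul0r.
have ex : exists i, r`_i != 0.
  by exists (size r).-1; rewrite -lead_coefE lead_coef_eq0.
case: (ex_minnP ex) => m rm minm.
have qm : q`_m = r`_m * p`_0.
  rewrite qr coefM big_ord_recr /= subnn big1 ?add0r // => i _.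
  suff -> : r`_i = 0 by rewrite mul0r.
  by apply/eqP; apply: contraTT (ltn_ord i); rewrite -leqNgt; exact: minm.
by have := qs m; rewrite qm; case: p0 => ->; move: rm; lia.
Qed.

Lemma norm_small_horner (F : numFieldType) (q : {poly int}) (k : nat) (z : F) :
  (forall i, `|q`_i| <= 1) -> (size q <= k)%N -> 1 < `|z| ->
  (`|z| - 1) * `|(map_poly intr q).[z]| <= `|z| ^+ k.
Proof.
move=> qs szq z1.
have z1' : 0 <= `|z| - 1 by rewrite subr_ge0 ltW.
apply: (@le_trans _ _ ((`|z| - 1) * \sum_(i < k) `|z| ^+ i)); last first.
  by rewrite -subrX1 gerBl.
rewrite ler_wpM2l // (@horner_coef_wide _ k); last first.
  by rewrite size_map_inj_poly //; exact: intr_inj.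
apply: le_trans (ler_norm_sum _ _ _) _; apply: ler_sum => i _.
rewrite normrM normrX coef_map /= -intr_norm ler_piMl ?exprn_ge0 //.
by rewrite -[1]/(1%:~R) ler_int.
Qed.

(** * Garsia's lemma and the separation of abscissae *)

Lemma garsia_horner_lower (R : realType) (x : R) : garsia x ->
  exists2 c : R, 0 < c & forall (q : {poly int}) (k : nat),
    (forall i, `|q`_i| <= 1) -> q != 0 -> (size q <= k)%N ->
    c * (x / 2) ^+ k <= `|(map_poly intr q).[x]|.
Proof.
case=> x0 [p [mp irr rx p0 gt1]].
have [s ps] := closed_field_poly_normal (map_poly (intr : int -> R[i]) p).
have mpC : map_poly (intr : int -> R[i]) p \is monic by exact: monic_map.
move: ps; rewrite (monicP mpC) scale1r => ps.
have rP z : root (map_poly (intr : int -> R[i]) p) z = (z \in s).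
  by rewrite ps root_prod_XsubC.
have horC (q : {poly int}) : (map_poly intr q).[x%:C%C] = ((map_poly intr q).[x])%:C%C :> R[i].
  rewrite -[RHS](horner_map (real_complex R)) -map_poly_comp /=; congr (_.[_]).
  by apply: eq_map_poly => i /=; rewrite rmorph_int.
have xs : x%:C%C \in s by rewrite -rP rootE horC (rootP rx).
have st := perm_to_rem xs; set t := rem _ _ in st.
have gt1t z : z \in t -> 1 < `|z|.
  by move=> zt; apply: gt1; rewrite rP (perm_mem st) inE zt orbT.
have normx : `|x%:C%C| = x%:C%C :> R[i] by rewrite ger0_norm // ler0c ltW.
have prodt : x%:C%C * \prod_(z <- t) `|z| = 2 :> R[i].
  have -> : x%:C%C * \prod_(z <- t) `|z| = \prod_(z <- s) `|z|.
    by rewrite (perm_big _ st) big_cons normx.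
  have -> : \prod_(z <- s) `|z| = `|(map_poly intr p).[0 : R[i]]|.
    rewrite ps horner_prod normr_prod; apply: eq_bigr => z _.
    by rewrite hornerXsubC sub0r normrN.
  rewrite horner_coef0.
  by rewrite coef_map; case: p0 => ->; rewrite /= ?rmorphN ?normrN normr_nat.
(* These are the denominators in the bounds [|z| ^+ k / (|z| - 1)], so the constant depends neither
   on [q] nor on [k]. *)
pose cC : R[i] := \prod_(z <- t) (`|z| - 1).
have cC0 : 0 < cC by rewrite /cC big_seq prodr_gt0 // => z /gt1t; rewrite subr_gt0.
(* Being positive in [R[i]] entails being real, so [cC] descends to [R]. *)
have cE : (complex.Re cC)%:C%C = cC by rewrite RRe_real // gtr0_real.
exists (complex.Re cC); first by rewrite -ltcR cE.
move=> q k qs q0 szq.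
have [m mE] := prod_roots_int q mp ps.
have mn0 : m != 0.
  rewrite -(intr_eq0 R[i]) -mE prodf_seq_neq0; apply/allP => z zs /=.
  by rewrite -rootE (small_poly_not_root mp irr p0 qs q0) ?rP.
have m1 : 1 <= `|\prod_(z <- s) (map_poly intr q).[z]|.
  rewrite mE -intr_norm -[1]/(1%:~R) ler_int; lia.
rewrite -lecR rmorphM rmorphXn rmorphM fmorphV /= cE rmorph_nat.
have -> : `|(map_poly intr q).[x]|%:C%C = `|(map_poly intr q).[x%:C%C]| :> R[i].
  by rewrite horC normc_def /= expr0n addr0 sqrtr_sqr.
(* By [prodt] the other conjugates have product of moduli [2 / x]; this is the source of the base
   [x / 2]. *)
have xk : (x%:C%C / 2) ^+ k * \prod_(z <- t) `|z| ^+ k = 1 :> R[i].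
  rewrite prodrXl -exprMn mulrAC prodt divff ?expr1n //.
move: m1; rewrite normr_prod (perm_big _ st) big_cons /= => m1.
have x20 : 0 <= (x%:C%C / 2) ^+ k :> R[i] by rewrite exprn_ge0 // divr_ge0 // ler0c ltW.
have step : cC <= `|(map_poly intr q).[x%:C%C]| * \prod_(z <- t) `|z| ^+ k.
  apply: (@le_trans _ _ (cC * (`|(map_poly intr q).[x%:C%C]| *
      \prod_(z <- t) `|(map_poly intr q).[z]|))).
    by rewrite ler_peMr // ltW.
  rewrite mulrCA ler_wpM2l // /cC -big_split /= big_seq [leRHS]big_seq.
  apply: ler_prod => z zt; rewrite mulr_ge0 ?subr_ge0 ?(ltW (gt1t z zt)) //=.
  by apply: norm_small_horner => //; exact: gt1t.
apply: le_trans (ler_wpM2r x20 step) _.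
by rewrite -mulrA [X in _ * X]mulrC xk mulr1.
Qed.

Lemma garsia_separation (R : realType) (lam : R) : 0 < lam -> lam <= 1 -> garsia lam^-1 ->
  exists2 c : R, 0 < c & forall (k : nat) (e : nat -> int),
    (forall i, `|e i| <= 1) -> (exists2 i, (i < k)%N & e i != 0) ->
    c / 2 ^+ k <= `|\sum_(i < k) (e i)%:~R * lam ^+ i|.
Proof.
move=> l0 l1 /garsia_horner_lower [c c0 cP].
exists c => // -[|k] e e1 [j jk ej0] //.
(* Reversing the coefficients turns a sum of powers of [lam] into [lam ^+ k] times a value at
   [lam^-1]. *)
pose q := \poly_(i < k.+1) e (k - i)%N.
have q1 i : `|q`_i| <= 1 by rewrite coef_poly; case: ifP; rewrite ?normr0.
have q0 : q != 0.
  apply/eqP => /(congr1 (fun r : {poly int} => r`_(k - j))).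
  rewrite coef_poly coef0 ltnS leq_subr subKn //; exact/eqP.
have -> : \sum_(i < k.+1) (e i)%:~R * lam ^+ i = lam ^+ k * (map_poly intr q).[lam^-1].
  rewrite (@horner_coef_wide _ k.+1); last first.
    by rewrite size_map_inj_poly ?size_poly //; exact: intr_inj.
  rewrite mulr_sumr [RHS](reindex_inj rev_ord_inj) /=; apply: eq_bigr => i _.
  have ik : (i <= k)%N by rewrite -ltnS.
  have qE : q`_(k - i) = e i by rewrite coef_poly ltnS leq_subr subKn.
  rewrite subSS coef_map qE mulrCA; congr (_ * _).
  by rewrite -[X in lam ^+ X * _](subnK ik) addnC exprD exprVn mulfK ?expf_neq0 ?gt_eqF.
rewrite normrM ger0_norm ?exprn_ge0 ?(ltW l0) //.
apply: (@le_trans _ _ (lam ^+ k * (c * (lam^-1 / 2) ^+ k.+1))); last first.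
  by rewrite ler_wpM2l ?exprn_ge0 ?(ltW l0) // cP ?size_poly.
(* The lower bound has exponent [k.+1] but only [lam ^+ k] was factored out; the spare [lam^-1] is
   at least 1 and is dropped. *)
have -> : lam ^+ k * (c * (lam^-1 / 2) ^+ k.+1) = lam^-1 * (c / 2 ^+ k.+1).
  have lk0 : lam ^+ k != 0 by rewrite expf_neq0 ?gt_eqF.
  rewrite expr_div_n exprVn (exprS lam).
  move: (lam ^+ k) (2 ^+ k.+1) lk0 => u v u0.
  by rewrite invfM mulrCA (mulrC lam^-1 u^-1) -mulrA mulVKf // mulrCA.
by rewrite ler_peMl ?invf_ge1 // divr_ge0 ?exprn_ge0 // ltW.
Qed.

(* The abscissa of [S_w] applied to the origin. *)
Fixpoint wpos (R : realType) (lam : R) (w : seq bool) : R :=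
  if w is b :: w' then lam * wpos lam w' + (1 - lam) * b%:R else 0.

Lemma wposE (R : realType) (lam : R) (w : seq bool) :
  wpos lam w = (1 - lam) * \sum_(i < size w) (nth false w i)%:R * lam ^+ i.
Proof.
elim: w => [|b w IH] /=; first by rewrite big_ord0 mulr0.
rewrite big_ord_recl /= expr0 mulr1 mulrDr addrC IH mulrCA mulr_sumr.
by congr (_ + _ * _); apply: eq_bigr => i _; rewrite /bump exprS mulrCA.
Qed.

Lemma wpos_separation (R : realType) (lam : R) : 0 < lam -> lam < 1 -> garsia lam^-1 ->
  exists2 c : R, 0 < c & forall w w' : seq bool, size w = size w' -> w != w' ->
    c / 2 ^+ size w <= `|wpos lam w - wpos lam w'|.
Proof.
move=> l0 l1 /(garsia_separation l0 (ltW l1)) [c c0 cP].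
exists ((1 - lam) * c); first by rewrite mulr_gt0 ?subr_gt0.
move=> w w' szw neq.
rewrite !wposE -szw -mulrBr -sumrB normrM gtr0_norm ?subr_gt0 //.
rewrite -mulrA ler_wpM2l ?subr_ge0 ?(ltW l1) //.
have -> : \sum_(i < size w) ((nth false w i)%:R * lam ^+ i - (nth false w' i)%:R * lam ^+ i)
   = \sum_(i < size w) ((nth false w i)%:R - (nth false w' i)%:R : int)%:~R * lam ^+ i.
  by apply: eq_bigr => i _; rewrite -mulrBl rmorphB /= !natz.
apply: (cP _ (fun i => (nth false w i)%:R - (nth false w' i)%:R : int)).
  by move=> i; do 2!case: nth.
have [i iw ni] : exists2 i, (i < size w)%N & nth false w i != nth false w' i.
  apply: contrapT => H; move/eqP: neq; apply; apply: (@eq_from_nth _ false) => // i iw.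
  by apply/eqP; apply: contraPT isT => ni _; apply: H; exists i.
by exists i => //; move: ni; do 2!case: nth.
Qed.

(** * Pillars and the strip containing the rest of the attractor *)

Lemma pillar_sub (R : realType) (lam : R) (F : set (R * R)) (w : seq bool) (y : R) :
  0 < lam -> F = S0 lam @` F `|` S1 lam @` F `|` @Cseg R ->
  0 <= y <= lam ^+ size w -> F (wpos lam w, y).
Proof.
move=> l0 FE.
elim: w y => [|b w IH] y /=; first by move=> y01; rewrite FE; right; split.
rewrite exprS => /andP[y0 y1].
have /IH Fq : 0 <= y / lam <= lam ^+ size w.
  by rewrite divr_ge0 ?(ltW l0)// ler_pdivrMr // mulrC.
rewrite FE; left; case: b; [right|left]; exists (wpos lam w, y / lam) => //;
  by rewrite /S0 /S1 /= ?mulr1 ?mulr0 ?addr0 mulrCA divff ?mulr1 ?gt_eqF.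
Qed.

(** Unrolling the fixed-point equation [K] times, a point either lands in a copy of the segment
    after fewer than [K] maps, or is the image of a point of [F] under [K] maps, each contracting
    heights by [lam]. *)
Lemma pillar_cover (R : realType) (lam : R) (F : set (R * R)) (B : R) (K : nat) (p : R * R) :
  0 < lam -> F = S0 lam @` F `|` S1 lam @` F `|` @Cseg R ->
  (forall q, F q -> `|q.2| <= B) -> F p ->
  (exists w, [/\ (size w < K)%N, p.1 = wpos lam w & 0 <= p.2 <= lam ^+ size w])
  \/ `|p.2| <= B * lam ^+ K.
Proof.
move=> l0 FE FB; elim: K p => [|K IH] p Fp; first by right; rewrite expr0 mulr1 FB.
have step (b : bool) q : F q -> p = (lam * q.1 + (1 - lam) * b%:R, lam * q.2) ->
    (exists w, [/\ (size w < K.+1)%N, p.1 = wpos lam w & 0 <= p.2 <= lam ^+ size w])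
    \/ `|p.2| <= B * lam ^+ K.+1.
  move=> /IH[[w [wK q1 /andP[q2 q2']]]|q2] ->; [left; exists (b :: w)|right] => /=.
    by rewrite q1 exprS mulr_ge0 ?ler_pM2l ?(ltW l0).
  by rewrite normrM (gtr0_norm l0) exprS mulrCA ler_pM2l.
move: Fp; rewrite {1}FE => -[[[q Fq qp]|[q Fq qp]]|[p1 p2]].
- by apply: (step false q Fq); rewrite -qp mulr0 addr0.
- by apply: (step true q Fq); rewrite -qp mulr1.
- by left; exists [::]; rewrite p1.
Qed.

Lemma compact_coord_bounded (R : realType) (F : set (R * R)) : compact F ->
  exists2 B : R, 0 <= B & forall q, F q -> `|q.1| <= B /\ `|q.2| <= B.
Proof.
move=> /compact_bounded [M [Mr MP]].
exists (`|M| + 1) => [|q Fq]; first by rewrite addr_ge0.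
have := MP (`|M| + 1); rewrite ltr_pwDr ?ler_norm // => /(_ isT q Fq) /=.
by rewrite prod_normE ge_max => /andP.
Qed.

(** * Counting mesh squares *)

Lemma mesh_squaresE (R : realType) (delta : R) (E : set (R * R)) : 0 < delta ->
  mesh_squares delta E = (fun p => (Num.floor (p.1 / delta), Num.floor (p.2 / delta))) @` E.
Proof.
move=> d0.
have cell (i : int) (x : R) :
    (i%:~R * delta <= x < (i + 1)%:~R * delta) = (Num.floor (x / delta) == i).
  by rewrite floor_eq ler_pdivlMr // ltr_pdivrMr.
apply/seteqP; split => [[i j] [p Ep] /=|_ [p Ep <-]].
  by rewrite !cell => -[/eqP <- /eqP <-]; exists p.
by exists p => //=; rewrite !cell.
Qed.

Lemma N_delta_le (R : realType) (delta : R) (E : set (R * R)) (s : seq (int * int)) :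
  mesh_squares delta E `<=` [set` s] -> (N_delta delta E <= size s)%N.
Proof.
move=> Es; rewrite /N_delta.
have fs : finite_set [set` s] by exact: finite_seq.
have : (fset_set (mesh_squares delta E) `<=` fset_set [set` s])%fset.
  by rewrite -(fset_set_sub (sub_finite_set Es fs) fs).
move=> /fsubset_leq_card /leq_trans; apply.
have -> : fset_set [set` s] = [fset x in s]%fset.
  by apply/fsetP => x; rewrite in_fset_set // inE mem_setE.
by rewrite card_fseq size_undup.
Qed.

(** Finiteness matters here: [fset_set] sends an infinite set to the empty one, making the count
    0. *)
Lemma N_delta_ge (R : realType) (delta : R) (E : set (R * R)) (s : seq (int * int)) :
  finite_set (mesh_squares delta E) -> uniq s -> [set` s] `<=` mesh_squares delta E ->
  (size s <= N_delta delta E)%N.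
Proof.
move=> fE us sE; rewrite /N_delta.
have <- : #|` [fset x in s]%fset| = size s by rewrite card_fseq undup_id.
apply: fsubset_leq_card; apply/fsubsetP => x; rewrite inE => xs.
by rewrite in_fset_set //; apply/mem_set/sE.
Qed.

(** The list serves both bounds: repetitions are harmless in a cover, and it is duplicate-free once
    distinct words of length [k] occupy distinct columns. *)
Definition pillar_squares (R : realType) (lam delta : R) (k : nat) : seq (int * int) :=
  [seq (Num.floor (wpos lam (val w) / delta), Posz j) |
     w <- enum {: k.-tuple bool}, j <- iota 0 (Num.truncn (lam ^+ k / delta)).+1].

Lemma size_pillar_squares (R : realType) (lam delta : R) (k : nat) :
  size (pillar_squares lam delta k) = (2 ^ k * (Num.truncn (lam ^+ k / delta)).+1)%N.
Proof. by rewrite size_allpairs size_iota -cardE card_tuple card_bool. Qed.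

Lemma mem_pillar_squares (R : realType) (lam delta : R) (w : seq bool) (y : R) :
  0 < lam -> 0 < delta -> 0 <= y <= lam ^+ size w ->
  (Num.floor (wpos lam w / delta), Num.floor (y / delta))
    \in pillar_squares lam delta (size w).
Proof.
move=> l0 d0 /andP[y0 y1].
have yd : 0 <= y / delta by rewrite divr_ge0 ?(ltW d0).
have -> : Num.floor (y / delta) = Posz (Num.truncn (y / delta)).
  by rewrite -(gez0_abs (_ : 0 <= Num.floor (y / delta))) ?floor_ge0 // truncn_floor yd.
apply: (allpairs_f (fun (w' : (size w).-tuple bool) j =>
     (Num.floor (wpos lam (val w') / delta), Posz j))
   (x := in_tuple w)); first by rewrite mem_enum.
by rewrite mem_iota /= add0n ltnS le_truncn // ler_wpM2r // invr_ge0 ltW.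
Qed.

Lemma pillars_cover (R : realType) (lam delta : R) (K : nat) : 0 < lam -> 0 < delta ->
  exists s : seq (int * int),
    (size s)%:R <= \sum_(i < K) 2 ^+ i * (lam ^+ i / delta + 1) /\
    forall w y, (size w < K)%N -> 0 <= y <= lam ^+ size w ->
      (Num.floor (wpos lam w / delta), Num.floor (y / delta)) \in s.
Proof.
move=> l0 d0; elim: K => [|K [s [szs sP]]]; first by exists [::]; rewrite big_ord0.
exists (s ++ pillar_squares lam delta K); split.
  rewrite size_cat natrD big_ord_recr /= lerD // size_pillar_squares natrM natrX.
  rewrite ler_wpM2l ?exprn_ge0 // -natr1 lerD2r truncn_le.
  by rewrite divr_ge0 ?exprn_ge0 ?(ltW l0) ?(ltW d0).
move=> w y; rewrite ltnS leq_eqVlt => /predU1P[<-|wK] yw; rewrite mem_cat.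
  by rewrite mem_pillar_squares ?orbT.
by rewrite sP.
Qed.

Lemma interval_cover (R : realType) (delta M : R) : 0 < delta -> 0 <= M ->
  exists s : seq int, (size s)%:R <= 2 * (M / delta) + 3 /\
    forall x, `|x| <= M -> Num.floor (x / delta) \in s.
Proof.
move=> d0 M0; pose L := (Num.truncn (M / delta)).+1.
have Md : 0 <= M / delta by rewrite divr_ge0 // ltW.
(* These are the [2 * L + 1] integers from [-L] to [L]; as [L] is the truncation plus 1, the
   additive constant is 3. *)
exists [seq Posz i - Posz L | i <- iota 0 (2 * L).+1]; split.
  have tM : (Num.truncn (M / delta))%:R <= M / delta by rewrite truncn_le.
  rewrite size_map size_iota /L -natr1 natrM -natr1; lra.
move=> x xM.
have Lx : `|x / delta| < L%:R.
  rewrite normrM normfV (gtr0_norm d0); apply: le_lt_trans (truncnS_gt _).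
  by rewrite ler_wpM2r ?invr_ge0 ?(ltW d0).
have [Lx1 Lx2] : - L%:R <= x / delta /\ x / delta < L%:R.
  by move: Lx; rewrite ltr_norml => /andP[/ltW].
have f1 : - (L%:Z) <= Num.floor (x / delta) by rewrite floor_ge_int rmorphN /= .
have f2 : Num.floor (x / delta) < L%:Z by rewrite floor_lt_int.
apply/mapP; exists (absz (Num.floor (x / delta) + L%:Z)); last by lia.
by rewrite mem_iota; lia.
Qed.

Lemma attractor_mesh_cover (R : realType) (lam delta : R) (F : set (R * R)) (B : R) (K : nat) :
  0 < lam -> F = S0 lam @` F `|` S1 lam @` F `|` @Cseg R ->
  0 <= B -> (forall q, F q -> `|q.1| <= B /\ `|q.2| <= B) -> 0 < delta ->
  exists s : seq (int * int), mesh_squares delta F `<=` [set` s] /\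
    (size s)%:R <= \sum_(i < K) 2 ^+ i * (lam ^+ i / delta + 1)
      + (2 * (B / delta) + 3) * (2 * (B * lam ^+ K / delta) + 3).
Proof.
move=> l0 FE B0 FB d0.
have [s [szs sP]] := pillars_cover K l0 d0.
have [s1 [sz1 s1P]] := interval_cover d0 B0.
have [s2 [sz2 s2P]] := interval_cover d0 (mulr_ge0 B0 (exprn_ge0 K (ltW l0))).
exists (s ++ [seq (i, j) | i <- s1, j <- s2]); split.
  rewrite mesh_squaresE // => _ [p Fp <-] /=; rewrite mem_cat.
  have [[w [wK -> pw]]|p2] := pillar_cover K l0 FE (fun q Fq => (FB q Fq).2) Fp.
    by rewrite sP.
  by rewrite allpairs_f ?orbT // ?s2P // s1P //; case: (FB p Fp).
by rewrite size_cat natrD lerD // size_allpairs natrM ler_pM.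
Qed.

Lemma attractor_mesh_lower (R : realType) (lam delta c : R) (F : set (R * R)) (k : nat) :
  0 < lam -> F = S0 lam @` F `|` S1 lam @` F `|` @Cseg R ->
  (forall w w' : seq bool, size w = size w' -> w != w' ->
    c / 2 ^+ size w <= `|wpos lam w - wpos lam w'|) ->
  0 < delta -> 2 ^+ k <= c / delta -> finite_set (mesh_squares delta F) ->
  (2 * lam) ^+ k / delta <= (N_delta delta F)%:R.
Proof.
move=> l0 FE sep d0 kc fin.
(* Two abscissae in one column differ by less than [delta], while distinct words give a gap of at
   least [c / 2 ^+ k], which is at least [delta]. *)
have sepd w w' : size w = k -> size w' = k ->
    Num.floor (wpos lam w / delta) = Num.floor (wpos lam w' / delta) -> w = w'.
  move=> szw szw' eqf; apply/eqP; apply/negP => /negP /(sep w w' (etrans szw (esym szw'))).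
  rewrite szw => dc.
  have : delta <= c / 2 ^+ k by rewrite ler_pdivlMr ?exprn_gt0 // mulrC -ler_pdivlMr.
  move/le_trans/(_ dc); apply/negP; rewrite -ltNge.
  rewrite -[ltRHS]mul1r -ltr_pdivrMr // -[in X in _ / X](gtr0_norm d0) -normf_div mulrBl.
  have := floor_itv (wpos lam w / delta); have := floor_itv (wpos lam w' / delta).
  rewrite eqf intrD ltr_norml => /andP[? ?] /andP[? ?]; apply/andP; split; lra.
have uq : uniq (pillar_squares lam delta k).
  apply: allpairs_uniq; rewrite ?enum_uniq ?iota_uniq //.
  move=> [w j] [w' j'] _ _ /= [eqw <-].
  by congr (_, _); apply/val_inj/sepd; rewrite ?size_tuple.
have sub : [set` pillar_squares lam delta k] `<=` mesh_squares delta F.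
  rewrite mesh_squaresE // => _ /allpairsP [[w j] [_ jm ->]].
  (* The witness sits on the bottom edge of its square, which belongs to the half-open cell. *)
  exists (wpos lam w, j%:R * delta) => /=;
    last by rewrite mulfK ?gt_eqF // -[j%:R]/((Posz j)%:~R) intrKfloor.
  apply: pillar_sub => //; rewrite mulr_ge0 ?(ltW d0) //= size_tuple -ler_pdivlMr //.
  move: jm; rewrite mem_iota add0n ltnS /= => jm.
  apply: (@le_trans _ _ (Num.truncn (lam ^+ k / delta))%:R); first by rewrite ler_nat.
  by rewrite truncn_le divr_ge0 ?exprn_ge0 ?ltW.
have := N_delta_ge fin uq sub; rewrite -(ler_nat R) => /(le_trans _); apply.
rewrite size_pillar_squares natrM natrX exprMn -mulrA ler_wpM2l ?exprn_ge0 //.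
exact/ltW/truncnS_gt.
Qed.

(** * Choice of scale and asymptotics *)

Lemma pow2_scale (R : realType) (y : R) : 1 <= y ->
  exists k : nat, 2 ^+ k <= y < 2 * 2 ^+ k.
Proof.
move=> y1; exists (trunc_log 2 (Num.truncn y)).
have n0 : (0 < Num.truncn y)%N by rewrite truncn_gt0.
have y0 : 0 <= y by apply: le_trans y1.
rewrite -exprS -!natrX; apply/andP; split.
  by rewrite -truncn_ge_nat // trunc_logP.
by rewrite -truncn_lt_nat // trunc_log_ltn.
Qed.

Lemma cover_size_bound (R : realType) (lam delta c B : R) (k : nat) :
  1 < 2 * lam -> lam < 1 -> 0 < delta -> 0 < c -> c <= 1 -> 0 <= B ->
  2 ^+ k <= c / delta < 2 * 2 ^+ k ->
  \sum_(i < k) 2 ^+ i * (lam ^+ i / delta + 1)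
      + (2 * (B / delta) + 3) * (2 * (B * lam ^+ k / delta) + 3)
  <= (2 / (2 * lam - 1) + 2 * (2 * B + 3) ^+ 2 / c) * ((2 * lam) ^+ k / delta).
Proof.
move=> l2 l1 d0 c0 c1 B0 /andP[k1 k2].
have l0 : 0 < lam by lra.
set u := delta^-1; have u0 : 0 < u by rewrite invr_gt0.
have cu : 2 ^+ k <= u by apply: le_trans k1 _; rewrite ler_piMl // ltW.
have lk0 : 0 < lam ^+ k by rewrite exprn_gt0.
(* This and [1 <= u] let the additive constants 1 and 3 be absorbed into the main terms. *)
have lku : 1 <= lam ^+ k * u.
  apply: (@le_trans _ _ (lam ^+ k * 2 ^+ k)); last by rewrite ler_pM2l.
  by rewrite -exprMn mulrC exprn_ege1 // ltW.
have u1 : 1 <= u by apply: le_trans cu; rewrite exprn_ege1 // ler1n.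
rewrite [leRHS]mulrDl; apply: lerD.
  apply: (@le_trans _ _ (2 * u * \sum_(i < k) (2 * lam) ^+ i)).
    rewrite mulr_sumr; apply: ler_sum => i _.
    have -> : 2 * u * (2 * lam) ^+ i = 2 ^+ i * (lam ^+ i * u + lam ^+ i * u).
      by rewrite exprMn; ring.
    rewrite ler_pM2l ?exprn_gt0 // lerD2l (le_trans lku) // ler_pM2r //.
    by apply: ler_wiXn2l; rewrite ?(ltW l0) ?(ltW l1) // ltnW.
  have -> : 2 / (2 * lam - 1) * ((2 * lam) ^+ k * u)
      = 2 * u * ((2 * lam) ^+ k / (2 * lam - 1)) by ring.
  rewrite ler_pM2l ?mulr_gt0 // ler_pdivlMr ?subr_gt0 // mulrC -subrX1; lra.
apply: (@le_trans _ _ ((2 * B + 3) * u * ((2 * B + 3) * (lam ^+ k * u)))).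
  apply: ler_pM.
  - by rewrite addr_ge0 // !mulr_ge0 // ltW.
  - by rewrite addr_ge0 // !mulr_ge0 // ltW.
  - by lra.
  - by lra.
(* The strip contributes a multiple of [lam ^+ k * u * u]; the upper choice of scale,
   [u < 2 * 2 ^+ k / c], converts one [u] into [2 ^+ k]. *)
have -> : 2 * (2 * B + 3) ^+ 2 / c * ((2 * lam) ^+ k * u)
        = (2 * B + 3) ^+ 2 * (lam ^+ k * u) * (2 * 2 ^+ k / c).
  by rewrite exprMn; ring.
have -> : (2 * B + 3) * u * ((2 * B + 3) * (lam ^+ k * u))
        = (2 * B + 3) ^+ 2 * (lam ^+ k * u) * u by ring.
rewrite ler_wpM2l ?mulr_ge0 ?exprn_ge0 ?(ltW u0) ?(ltW l0) ?addr_ge0 ?mulr_ge0 //.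
by rewrite ler_pdivlMr // mulrC ltW.
Qed.

(* With [T = (2 * lam) ^+ k / delta], one has
   [ln N - L * (ln (4 * lam) / ln 2) = (ln N - ln T) + ln (2 * lam) / ln 2 * (k * ln 2 - L)]
   where [L = - ln delta], and both summands are bounded. *)
Lemma log_asymptotics (R : realType) (lam delta c A N : R) (k : nat) :
  1 < 2 * lam -> 0 < delta -> delta < 1 -> 0 < c -> c <= 1 ->
  2 ^+ k <= c / delta < 2 * 2 ^+ k ->
  (2 * lam) ^+ k / delta <= N <= A * ((2 * lam) ^+ k / delta) -> 0 < A ->
  `| ln N / (- ln delta) - ln (4 * lam) / ln 2 |
    <= (ln A + ln (2 * lam) / ln 2 * (ln 2 - ln c)) / (- ln delta).
Proof.
move=> l2 d0 d1 c0 c1 /andP[k1 k2] /andP[N1 N2] A0.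
have l20 : 0 < 2 * lam by lra.
have L0 : 0 < - ln delta by rewrite oppr_gt0 ln_lt0 // d0.
set L := - ln delta in L0 *.
have ln2 : 0 < ln 2 :> R by rewrite ln_gt0 // ltr1n.
have lnl : 0 < ln (2 * lam) by rewrite ln_gt0.
have lnc : ln c <= 0 by rewrite ln_le0.
have T0 : 0 < (2 * lam) ^+ k / delta by rewrite divr_gt0 ?exprn_gt0.
have N0 : 0 < N by apply: lt_le_trans N1.
have lnT : ln ((2 * lam) ^+ k / delta) = ln (2 * lam) *+ k + L.
  by rewrite lnM ?posrE ?invr_gt0 ?exprn_gt0 // lnXn // lnV ?posrE.
have lnN1 : ln (2 * lam) *+ k + L <= ln N by rewrite -lnT ler_ln ?posrE.
have lnN2 : ln N <= ln A + (ln (2 * lam) *+ k + L).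
  by rewrite -lnT -lnM ?posrE // ler_ln ?posrE // mulr_gt0.
have kL1 : ln 2 *+ k <= ln c + L :> R.
  by rewrite -lnXn // /L -lnV ?posrE // -lnM ?posrE ?invr_gt0 //
    ler_ln ?posrE ?exprn_gt0 ?divr_gt0.
have kL2 : ln c + L <= ln 2 + ln 2 *+ k :> R.
  rewrite -[ln 2 *+ k]lnXn // /L -lnV ?posrE // -!lnM ?posrE ?invr_gt0 ?exprn_gt0 //.
  by rewrite ler_ln ?posrE ?mulr_gt0 ?exprn_gt0 ?invr_gt0 // ltW.
have -> : ln (4 * lam) = ln 2 + ln (2 * lam).
  by rewrite -lnM ?posrE //; congr ln; ring.
move: lnN1 lnN2 kL1 kL2; rewrite -(mulr_natr (ln (2 * lam)) k) -(mulr_natr (ln 2) k).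
move: (ln N) (ln A) (ln (2 * lam)) (ln 2) (ln c) lnl ln2 lnc.
move=> n a g h cc g0 h0 cc0 n1 n2 q1 q2.
have -> : n / L - (h + g) / h = (n - L - g / h * L) / L.
  by field; rewrite !gt_eqF.
rewrite normrM (gtr0_norm (_ : 0 < L^-1)) ?invr_gt0 // ler_pM2r ?invr_gt0 //.
have gh0 : 0 < g / h by rewrite divr_gt0.
have gE : g = g / h * h by rewrite divfK // gt_eqF.
(* With the ratio named [r], the products by [r] below are the only nonlinear inputs. Nonnegativity
   of [a], needed for the lower bound, follows from [n1] and [n2]. *)
move: (g / h) gh0 gE => r r0 gE; subst g.
have m1 : r * (h * k%:R) <= r * (cc + L) by rewrite ler_pM2l.
have m2 : r * (cc + L) <= r * (h + h * k%:R) by rewrite ler_pM2l.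
have m3 : r * cc <= 0 by rewrite mulr_ge0_le0 // ltW.
have m4 : 0 <= r * h by rewrite ltW // mulr_gt0.
by rewrite ler_norml; apply/andP; split; lra.
Qed.

Theorem theorem2p4 (R : realType) (lam : R) (F : set (R * R)) :
  1 / 2 < lam < 1 ->
  garsia lam^-1 ->
  F !=set0 -> compact F ->
  F = S0 lam @` F `|` S1 lam @` F `|` @Cseg R ->
  exists (K : R) (d0 : R), 0 < d0 /\
    forall delta : R, 0 < delta < d0 ->
      `| ln (N_delta delta F)%:R / (- ln delta) - ln (4 * lam) / ln 2 |
        <= K / (- ln delta).
Proof.
move=> /andP[l12 l1] gar _ cF FE.
have l2 : 1 < 2 * lam by lra.
have l0 : 0 < lam by lra.
have [c0 c00 sep0] := wpos_separation l0 l1 gar.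
(* Capping at 1 makes [delta < c] imply both [delta < 1] and [1 <= c / delta], so that the logarithm
   has a sign and a scale [k] exists. *)
pose c := Num.min c0 1.
have cp : 0 < c by rewrite lt_min c00 ltr01.
have c1 : c <= 1 by rewrite ge_min lexx orbT.
have sep w w' : size w = size w' -> w != w' ->
    c / 2 ^+ size w <= `|wpos lam w - wpos lam w'|.
  move=> sw nw; apply: le_trans (sep0 w w' sw nw).
  by rewrite ler_pM2r ?invr_gt0 ?exprn_gt0 // ge_min lexx.
have [B B0 FB] := compact_coord_bounded cF.
pose A := 2 / (2 * lam - 1) + 2 * (2 * B + 3) ^+ 2 / c.
have A0 : 0 < A.
  apply: ltr_pwDl; first by rewrite divr_gt0 // subr_gt0.
  by rewrite divr_ge0 ?(ltW cp) // mulr_ge0 // sqr_ge0.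
exists (ln A + ln (2 * lam) / ln 2 * (ln 2 - ln c)), c; split=> // delta /andP[d0 dc].
have [|k kP] := @pow2_scale _ (c / delta).
  by rewrite ler_pdivlMr // mul1r ltW.
have [s [Fs szs]] := attractor_mesh_cover k l0 FE B0 FB d0.
apply: log_asymptotics A0 => //; first exact: lt_le_trans c1.
  exact: kP.
apply/andP; split.
  apply: (@attractor_mesh_lower _ _ _ c) => //; first by case/andP: kP.
  (* The cover built for the upper bound also supplies the finiteness that the lower bound
     requires. *)
  exact: sub_finite_set Fs (finite_seq _).
apply: le_trans (cover_size_bound l2 l1 d0 cp c1 B0 kP).
by apply: le_trans szs; rewrite ler_nat N_delta_le.
Qed.
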